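(* Let $\mathcal{T}$ be an associative conformal algebra, $\mathcal{U}$ a conformal $\mathcal{T}$-bimodule, $H$ a Hochschild $2$-cocycle of $\mathcal{T}$ with coefficients in $\mathcal{U}$, and $R:\mathcal{U}\to\mathcal{T}$ a conformal $H$-twisted Rota-Baxter operator. Let $R_t=\sum_{i\ge0}t^iR_i$ be a formal one-parameter deformation of $R$. Then the linear term $R_1$ is a $1$-cocycle in the cohomology of $R$, and its cohomology class is determined only by the equivalence class of the deformation $R_t$ (that is, if $R_t=\sum_{i\ge0}t^iR_i$ and $R'_t=\sum_{i\ge0}t^iR'_i$ are equivalent formal one-parameter deformations of $R$, then $R_1$ and $R'_1$ have the same cohomology class).
   Context: Everything is over $\mathbb{C}$. An associative conformal algebra is a $\mathbb{C}[\partial]$-module $\mathcal{T}$ with a $\lambda$-product $\mathcal{T}\otimes\mathcal{T}\to\mathcal{T}[\lambda]$, $p\otimes q\mapsto p_\lambda q$, that is conformally sesquilinear ($(\partial p)_\lambda q=-\lambda\,p_\lambda q$, $p_\lambda(\partial q)=(\partial+\lambda)(p_\lambda q)$) and satisfies $(p_\lambda q)_{\lambda+\mu}r=p_\lambda(q_\mu r)$. A conformal $\mathcal{T}$-bimodule is a $\mathbb{C}[\partial]$-module $\mathcal{U}$ with conformally sesquilinear maps $\mathcal{T}\otimes\mathcal{U}\to\mathcal{U}[\lambda]$, $(p,u)\mapsto p_\lambda u$, and $\mathcal{U}\otimes\mathcal{T}\to\mathcal{U}[\lambda]$, $(u,p)\mapsto u_\lambda p$, with $(p_\lambda u)_{\lambda+\mu}q=p_\lambda(u_\mu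 q)$, $(u_\lambda p)_{\lambda+\mu}q=u_\lambda(p_\mu q)$, $(p_\lambda q)_{\lambda+\mu}u=p_\lambda(q_\mu u)$. A Hochschild $2$-cocycle is a conformally sesquilinear map $H_\lambda:\mathcal{T}\otimes\mathcal{T}\to\mathcal{U}[\lambda]$ with ${p_1}_{\lambda_1}H_{\lambda_2}(p_2,p_3)-H_{\lambda_1+\lambda_2}({p_1}_{\lambda_1}p_2,p_3)+H_{\lambda_1}(p_1,{p_2}_{\lambda_2}p_3)-H_{\lambda_1}(p_1,p_2)_{\lambda_1+\lambda_2}p_3=0$. $\mathbb{C}[\partial]$-linear maps are extended coefficientwise to polynomials in $\lambda$. A conformal $H$-twisted Rota-Baxter operator is a $\mathbb{C}[\partial]$-linear map $R:\mathcal{U}\to\mathcal{T}$ with $R(u)_\lambda R(v)=R\big(u_\lambda R(v)+R(u)_\lambda v+H_\lambda(R(u),R(v))\big)$ for all $u,v\in\mathcal{U}$. If $x_\mu y=\sum_n\mu^nc_n$, then $x_{-\partial-\lambda}y=\sum_n(-\partial-\lambda)^nc_n$. Throughout, $\lambda$ is a free parameter. Low-degree cohomology of $R$: a $1$-cocycle is a $\mathbb{C}[\partial]$-linear map $g\in\mathrm{Hom}(\mathcal{U},\mathcal{T})$ with $d_R(g)=0$, which means that for all $u,v\in\mathcal{U}$ $$R(u)_\lambda g(v)+g(u)_\lambda R(v)=R\big(u_\lambda g(v)+g(u)_\lambda v+H_\lambda(R(u),g(v))+H_\lambda(g(u),R(v))\big)+g\big(u_\lambda R(v)+R(u)_\lambda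 v+H_\lambda(R(u),R(v))\big).$$ The $1$-coboundaries are the $d_R(p)$, $p\in\mathcal{T}$, where $d_R(p)$ is given, with the parameter $\lambda$, by $$d_R(p)_\lambda(u)=R\big(p_\lambda u-u_{-\partial-\lambda}p+H_\lambda(p,R(u))-H_\lambda(R(u),p)\big)-\big(p_\lambda R(u)-R(u)_{-\partial-\lambda}p\big).$$ Two $1$-cocycles $g,g'$ have the same cohomology class if they differ by a coboundary, i.e. $g(u)-g'(u)=d_R(p)_\lambda(u)$ for all $u\in\mathcal{U}$, for some $p\in\mathcal{T}$. The $\lambda$-product of $\mathcal{T}$, the bimodule actions on $\mathcal{U}$ and $H$ are extended to the formal power series $\mathcal{T}[[t]]$ and $\mathcal{U}[[t]]$. A formal one-parameter deformation of $R$ is a formal sum $R_t=\sum_{i\ge0}t^iR_i\in\mathrm{Hom}(\mathcal{U},\mathcal{T})[[t]]$ with $R_0=R$ such that $R_t:\mathcal{U}[[t]]\to\mathcal{T}[[t]]$ is a conformal $H$-twisted Rota-Baxter operator; equivalently, for all $u_1,u_2\in\mathcal{U}$, $R_t(u_1)_\lambda R_t(u_2)=R_t\big({u_1}_\lambda R_t(u_2)+R_t(u_1)_\lambda u_2+H_\lambda(R_t(u_1),R_t(u_2))\big)$. A morphism of conformal $H$-twisted Rota-Baxter operators from $R$ to $R'$ is a pair $(\phi,\psi)$ of an algebra morphism $\phi$ of $\mathcal{T}$ and a linear map $\psi$ of $\mathcal{U}$ with $\psi(q_\mu u)=\phi(q)_\mu\psi(u)$, $\psi(u_\mu q)=\psi(u)_\mu\phi(q)$,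 $\psi\circ H_\mu=H_\mu\circ(\phi\otimes\phi)$ and $\phi\circ R=R'\circ\psi$, for $q\in\mathcal{T}$, $u\in\mathcal{U}$ (with $\mathcal{T}[[t]]$, $\mathcal{U}[[t]]$ in place of $\mathcal{T}$, $\mathcal{U}$ for formal deformations). Two formal one-parameter deformations $R_t=\sum_{i\ge0}t^iR_i$ and $R'_t=\sum_{i\ge0}t^iR'_i$ of $R$ are equivalent if there exist an element $p\in\mathcal{T}$ and linear maps $\phi_i\in\mathrm{Hom}(\mathcal{T},\mathcal{T})$, $\psi_i\in\mathrm{Hom}(\mathcal{U},\mathcal{U})$ for $i\ge2$ such that $$\phi_t=\mathrm{id}_{\mathcal{T}}+t(\mathrm{ad}^l_p-\mathrm{ad}^r_p)+\sum_{i\ge2}t^i\phi_i,\qquad \psi_t=\mathrm{id}_{\mathcal{U}}+t\big(\mathfrak{l}_p-\mathfrak{r}_p+H_\lambda(p,R-)-H_\lambda(R-,p)\big)+\sum_{i\ge2}t^i\psi_i$$ form a morphism of conformal $H$-twisted Rota-Baxter operators from $R_t$ to $R'_t$. Here $\mathrm{ad}^l_p(q)=p_\lambda q$, $\mathrm{ad}^r_p(q)=q_{-\partial-\lambda}p$, $\mathfrak{l}_p(u)=p_\lambda u$, $\mathfrak{r}_p(u)=u_{-\partial-\lambda}p$. *)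

(* Defs.v *)
From HB Require Import structures.
From mathcomp Require Import all_boot all_order all_algebra.
From mathcomp Require Import finmap reals.
From mathcomp.real_closed Require Export complex.
From mathcomp.multinomials Require Import monalg.

Set Implicit Arguments.
Unset Strict Implicit.
Unset Printing Implicit Defensive.

Import GRing.Theory.
Local Open Scope ring_scope.
Local Open Scope complex_scope.

(* [lam M] is M[λ] for an A-module M: a finitely supported family of         *)
(* coefficients f@_n in M.  It is a module over A[λ] = {poly A}, so that the  *)
(* construction iterates: [lam (lam M)] is M[λ][μ], a module over A[λ][μ].    *)
Definition lam (A : nzRingType) (M : lmodType A) : Type := {malg M[nat]}.

Section LamModule.
Context (A : nzRingType) (M : lmodType A).

HB.instance Definition _ := GRing.Zmodule.on (lam M).

Implicit Types (P Q : {poly A}) (f g : lam M).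

Definition lam_scale P f : lam M :=
  \sum_(i < size P) \sum_(n <- msupp f) << P`_i *: f@_n *g (i + n)%N >>.

Lemma lam_scaleE P f k :
  (lam_scale P f)@_k = \sum_(i < k.+1) P`_i *: f@_(k - i)%N.
Proof.
pose G i := if (i <= k)%N then P`_i *: f@_(k - i)%N else 0.
have inner i : (\sum_(n <- msupp f) << P`_i *: f@_n *g (i + n)%N >>)@_k = G i.
  rewrite raddf_sum /= /G; case: leqP => [le_ik|lt_ki].
    rewrite [in RHS](monalgE f) !raddf_sum /=.
    apply: eq_bigr => n _; rewrite !mcoeffU scalerMnr.
    by rewrite -(eqn_add2l i n) subnKC.
  rewrite big1 // => n _; rewrite mcoeffU.
  by case: eqP lt_ki => // <-; rewrite ltnNge leq_addr.
rewrite /lam_scale raddf_sum /= (eq_bigr (fun i : 'I__ => G i)) //.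
rewrite (eq_bigr (fun i : 'I_k.+1 => G i)); last first.
  by move=> [i lt_ik] _ /=; rewrite /G -ltnS lt_ik.
rewrite [LHS](big_ord_widen _ G (leq_addr k.+1 (size P))).
rewrite [RHS](big_ord_widen _ G (leq_addl (size P) k.+1)).
rewrite [LHS]big_mkcond [RHS]big_mkcond; apply: eq_bigr => i _ /=.
rewrite /G ltnS; case: (leqP i k) => _; last by rewrite if_same.
by case: ltnP => // /(nth_default 0)->; rewrite scale0r.
Qed.

Lemma lam_scaleA P Q f : lam_scale P (lam_scale Q f) = lam_scale (P * Q) f.
Proof.
apply/malgP => k; rewrite !lam_scaleE.
under eq_bigr => i _ do rewrite lam_scaleE scaler_sumr.
under [RHS]eq_bigr => i _ do rewrite coefM scaler_suml.
pose E i j := (P`_i * Q`_j) *: f@_(k - (i + j))%N.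
transitivity (\sum_(i < k.+1) \sum_(j < k.+1 | (i + j <= k)%N) E i j).
  apply: eq_bigr => -[i lt_ik] _ /=.
  have le_ik : ((k - i).+1 <= k.+1)%N by rewrite ltnS leq_subr.
  rewrite (big_ord_widen _ (fun j => P`_i *: (Q`_j *: f@_(k - i - j)%N)) le_ik).
  apply: eq_big => [j|j _]; last by rewrite /E scalerA subnDA.
  by rewrite ltnS leq_subRL.
transitivity (\sum_(i < k.+1) \sum_(s < k.+1 | (i <= s)%N) E i (s - i)%N).
  apply: eq_bigr => -[i lt_ik] _ /=.
  rewrite -(big_mkord (fun j => i + j <= k)%N (E i)).
  rewrite -(big_mkord (fun s => i <= s)%N (fun s => E i (s - i)%N)).
  rewrite -(big_nat_widenl i 0 k.+1 predT) //.
  transitivity (\sum_(0 <= j < k.+1 - i) E i j).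
    rewrite (big_nat_widen 0 _ _ predT _ (leq_subr i k.+1)).
    by apply: eq_bigl => j; rewrite /= ltn_subRL ltnS.
  have shift F : \sum_(i <= s < k.+1) F s =
                 \sum_(0 <= j < k.+1 - i) F (j + i)%N :> M.
    by rewrite -{1}(add0n i) big_addn.
  by rewrite shift; apply: eq_bigr => j _; rewrite addnK.
rewrite (exchange_big_dep predT) //=; apply: eq_bigr => -[s lt_sk] _ /=.
rewrite (big_ord_widen _ (fun i => (P`_i * Q`_(s - i)) *: f@_(k - s)%N) lt_sk).
by apply: eq_bigr => i le_is; rewrite /E subnKC.
Qed.

Lemma lam_scale1 f : lam_scale 1 f = f.
Proof.
apply/malgP => k; rewrite lam_scaleE big_ord_recl big1 => [|i _].
  by rewrite coef1 scale1r subn0 addr0.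
by rewrite coef1 scale0r.
Qed.

Lemma lam_scaleDr P f g : lam_scale P (f + g) = lam_scale P f + lam_scale P g.
Proof.
apply/malgP => k; rewrite mcoeffD !lam_scaleE -big_split /=.
by apply: eq_bigr => i _; rewrite mcoeffD scalerDr.
Qed.

Lemma lam_scaleDl f P Q : lam_scale (P + Q) f = lam_scale P f + lam_scale Q f.
Proof.
apply/malgP => k; rewrite mcoeffD !lam_scaleE -big_split /=.
by apply: eq_bigr => i _; rewrite coefD scalerDl.
Qed.

HB.instance Definition _ := GRing.Zmodule_isLmodule.Build {poly A} (lam M)
  lam_scaleA lam_scale1 lam_scaleDr lam_scaleDl.

Definition lamC (x : M) : lam M := << x *g 0%N >>.

End LamModule.

(* For f = \sum_n λ^n x_n, the element \sum_n s^n g(x_n) obtained by          *)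
(* substituting s for λ and applying g to the coefficients.                   *)
Definition lam_subst (A B : nzRingType) (X : lmodType A) (N : lmodType B)
    (g : X -> N) (s : B) (f : lam X) : N :=
  \sum_(n <- msupp f) s ^+ n *: g f@_n.

Section Conformal.
Context {RR : realType}.
Local Notation C := RR[i].

(* A C[∂]-module is a module over {poly C}, the indeterminate being ∂.        *)
Local Notation module := (lmodType {poly C}).
Implicit Types X Y Z : module.

(* In C[∂]. *)
Definition D0 : {poly C} := 'X.
(* In C[∂][λ]. *)
Definition D1 : {poly {poly C}} := 'X%:P.
Definition L1 : {poly {poly C}} := 'X.
(* In C[∂][λ][μ]. *)
Definition L2 : {poly {poly {poly C}}} := 'X%:P.
Definition M2 : {poly {poly {poly C}}} := 'X.

(* h(x_n) coefficientwise on X[λ]. *)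
Definition lam_map X Y (h : X -> Y) : lam X -> lam Y :=
  lam_subst (fun x => lamC (h x)) L1.

(* f(λ) |-> f(-∂-λ). *)
Definition lam_opp X : lam X -> lam X := lam_subst (@lamC _ X) (- D1 - L1).

(* f(λ) |-> f(s) in X[λ][μ]. *)
Definition ev2 X (s : {poly {poly {poly C}}}) : lam X -> lam (lam X) :=
  lam_subst (fun x => lamC (lamC x)) s.

(* If f is x_λ x', [nestl B f y] is (x_λ x')_{λ+μ} y. *)
Definition nestl X Y Z (B : X -> Y -> lam Z) (f : lam X) (y : Y) :
    lam (lam Z) :=
  lam_subst (fun x => ev2 (L2 + M2) (B x y)) L2 f.

(* If g is y_λ y', [nestr B x g] is x_λ (y_μ y'). *)
Definition nestr X Y Z (B : X -> Y -> lam Z) (x : X) (g : lam Y) :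
    lam (lam Z) :=
  lam_subst (fun y => ev2 L2 (B x y)) M2 g.

Definition C_linear X Y (h : X -> Y) : Prop :=
  forall (a : C) x x', h (a%:P *: x + x') = a%:P *: h x + h x'.

Record sesquilinear X Y Z (B : X -> Y -> lam Z) : Prop := {
  sesqC_l : forall (a : C) x x' y,
    B (a%:P *: x + x') y = a%:P%:P *: B x y + B x' y;
  sesqC_r : forall (a : C) x y y',
    B x (a%:P *: y + y') = a%:P%:P *: B x y + B x y';
  sesqD_l : forall x y, B (D0 *: x) y = - (L1 *: B x y);
  sesqD_r : forall x y, B x (D0 *: y) = (D1 + L1) *: B x y }.

Context {T U : module}.
Implicit Types (m : T -> T -> lam T) (l : T -> U -> lam U)
  (r : U -> T -> lam U) (H : T -> T -> lam U).

Record assoc_conformal_algebra m : Prop := {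
  assoc_sesq : sesquilinear m;
  assoc_assoc : forall p q s, nestl m (m p q) s = nestr m p (m q s) }.

Record conformal_bimodule m l r : Prop := {
  bimod_sesql : sesquilinear l;
  bimod_sesqr : sesquilinear r;
  bimod_lr : forall p u q, nestl r (l p u) q = nestr l p (r u q);
  bimod_rm : forall u p q, nestl r (r u p) q = nestr r u (m p q);
  bimod_ml : forall p q u, nestl l (m p q) u = nestr l p (l q u) }.

Record hochschild_2cocycle m l r H : Prop := {
  cocycle_sesq : sesquilinear H;
  cocycle_eq : forall p1 p2 p3,
    nestr l p1 (H p2 p3) - nestl H (m p1 p2) p3
      + nestr H p1 (m p2 p3) - nestl r (H p1 p2) p3 = 0 }.

Definition twisted_RB m l r H (R : {linear U -> T}) : Prop :=
  forall u v, m (R u) (R v) = lam_map R (r u (R v) + l (R u) v + H (R u) (R v)).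

Definition one_cocycle m l r H (R g : {linear U -> T}) : Prop :=
  forall u v,
    m (R u) (g v) + m (g u) (R v) =
      lam_map R (r u (g v) + l (g u) v + H (R u) (g v) + H (g u) (R v))
      + lam_map g (r u (R v) + l (R u) v + H (R u) (R v)).

Definition coboundary m l r H (R : {linear U -> T}) (p : T) (u : U) : lam T :=
  lam_map R (l p u - lam_opp (r u p) + H p (R u) - H (R u) p)
  - (m p (R u) - lam_opp (m (R u) p)).

Definition same_class m l r H (R g g' : {linear U -> T}) : Prop :=
  exists p, forall u, lamC (g u - g' u) = coboundary m l r H R p u.

(* A formal power series in t is its sequence of coefficients.  [tprod B] is  *)
(* the t-bilinear extension of B to series.                                   *)
Definition tprod (X Y : Type) (Z : nmodType) (B : X -> Y -> Z)
    (x : nat -> X) (y : nat -> Y) : nat -> Z :=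
  fun n => \sum_(i < n.+1) B (x i) (y (n - i)%N).

(* The series of maps h = \sum_i t^i h_i applied to a series. *)
Definition tapp (X : Type) (Y : nmodType) (h : nat -> X -> Y) (x : nat -> X) :
    nat -> Y :=
  tprod (fun hi xj => hi xj) h x.

Definition formal_deformation m l r H (R : {linear U -> T})
    (Rt : nat -> {linear U -> T}) : Prop :=
  (forall u, Rt 0%N u = R u) /\
  forall u v : nat -> U,
    let Ru := tapp (fun i => Rt i) u in
    let Rv := tapp (fun i => Rt i) v in
    tprod m Ru Rv =1
    tapp (fun i => lam_map (Rt i))
      (fun n => tprod r u Rv n + tprod l Ru v n + tprod H Ru Rv n).

(* The free parameter λ of an equivalence is kept apart from the spectral     *)
(* parameter μ of the products: the coefficients of φ_t and ψ_t take values   *)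
(* in T[λ] and U[λ], and identities between products live in T[λ][μ] and      *)
(* U[λ][μ].                                                                   *)

(* h(f(μ)), for h with values in Y[λ]. *)
Definition mu_map X Y (h : X -> lam Y) : lam X -> lam (lam Y) :=
  lam_subst (fun x => lamC (h x)) M2.

(* f(λ)_μ g(λ). *)
Definition mu_prod X Y Z (B : X -> Y -> lam Z) (f : lam X) (g : lam Y) :
    lam (lam Z) :=
  lam_subst (fun x => lam_subst (fun y => ev2 M2 (B x y)) L2 g) L2 f.

Record formal_morphism m l r H (phi : nat -> T -> lam T)
    (psi : nat -> U -> lam U) (Rt Rt' : nat -> {linear U -> T}) : Prop := {
  morph_alg : forall p q : nat -> T,
    tapp (fun i => mu_map (phi i)) (tprod m p q) =1
    tprod (mu_prod m) (tapp phi p) (tapp phi q);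
  morph_l : forall (q : nat -> T) (u : nat -> U),
    tapp (fun i => mu_map (psi i)) (tprod l q u) =1
    tprod (mu_prod l) (tapp phi q) (tapp psi u);
  morph_r : forall (u : nat -> U) (q : nat -> T),
    tapp (fun i => mu_map (psi i)) (tprod r u q) =1
    tprod (mu_prod r) (tapp psi u) (tapp phi q);
  morph_H : forall p q : nat -> T,
    tapp (fun i => mu_map (psi i)) (tprod H p q) =1
    tprod (mu_prod H) (tapp phi p) (tapp phi q);
  morph_R : forall u : nat -> U,
    tapp phi (tapp (fun i => Rt i) u) =1
    tapp (fun i => lam_map (Rt' i)) (tapp psi u) }.

Definition phi_series m (p : T) (phi : nat -> T -> T) (n : nat) (q : T) :
    lam T :=
  match n with
  | 0 => lamC q
  | 1 => m p q - lam_opp (m q p)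
  | _ => lamC (phi n q)
  end.

Definition psi_series l r H (R : {linear U -> T}) (p : T)
    (psi : nat -> U -> U) (n : nat) (u : U) : lam U :=
  match n with
  | 0 => lamC u
  | 1 => l p u - lam_opp (r u p) + H p (R u) - H (R u) p
  | _ => lamC (psi n u)
  end.

(* The coefficients phi_i and psi_i are only asked to be C-linear: phi_1 does *)
(* not commute with ∂, as phi_1(∂q) = (∂+λ) phi_1(q).                         *)
Definition equivalent_deformations m l r H (R : {linear U -> T})
    (Rt Rt' : nat -> {linear U -> T}) : Prop :=
  exists (p : T) (phi : nat -> T -> T) (psi : nat -> U -> U),
    (forall i, (2 <= i)%N -> C_linear (phi i) /\ C_linear (psi i)) /\
    formal_morphism m l r H (phi_series m p phi) (psi_series l r H R p psi)
      Rt Rt'.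

End Conformal.

(* Main.v *)
Require Import Defs.
From mathcomp Require Import all_boot all_order all_algebra.
From mathcomp Require Import finmap reals.
From mathcomp.multinomials Require Import monalg.
Import GRing.Theory.
Local Open Scope ring_scope.
Local Open Scope complex_scope.

(** Apply the defining identities to series concentrated in degree 0 and read
    off the coefficient of t.  The identity of the deformation becomes the
    cocycle condition for R_1, and phi_t (R_t u) = R'_t (psi_t u) becomes
    R_1 u + phi_1 (R u) = R (psi_1 u) + R'_1 u, that is,
    R_1 u - R'_1 u = R (psi_1 u) - phi_1 (R u) = d_R(p)(u). *)

Lemma lamCB (A : nzRingType) (M : lmodType A) (x y : M) :
  lamC (x - y) = lamC x - lamC y.
Proof. exact: monalgUB. Qed.

Lemma lamC0 (A : nzRingType) (M : lmodType A) : lamC (0 : M) = 0.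
Proof. exact: monalgU0. Qed.

Section CoefficientMaps.
Context {RR : realType} {X Y : lmodType {poly RR[i]}}.

(** A deformation gives [R_0 = R] only pointwise; this carries that equality to coefficientwise
    extensions. *)
Lemma eq_lam_map (g h : X -> Y) : g =1 h -> lam_map g =1 lam_map h.
Proof. by move=> gh f; apply: eq_bigr => n _; rewrite gh. Qed.

Lemma lam_mapC (h : {linear X -> Y}) (x : X) :
  lam_map h (lamC x) = lamC (h x).
Proof.
(* The support of [lamC x] is empty when [x = 0], hence the case split. *)
rewrite /lam_map /lam_subst /lamC msuppU; case: eqP => [->|_].
  by rewrite big_nil linear0 monalgU0.
by rewrite big_seq_fset1 mcoeffUU expr0 scale1r.
Qed.

End CoefficientMaps.

Section Sesquilinear.
Context {RR : realType} {X Y Z : lmodType {poly RR[i]}}.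
Context {B : X -> Y -> lam Z} (hB : sesquilinear B).

(** Additivity with [a = 1] at zero arguments gives [B 0 y = B 0 y + B 0 y]; cancel. *)
Lemma sesq0l y : B 0 y = 0.
Proof.
have := sesqC_l hB 1 0 0 y; rewrite scaler0 addr0 !polyC1 scale1r => e.
by apply: (addrI (B 0 y)); rewrite addr0 -e.
Qed.

Lemma sesq0r x : B x 0 = 0.
Proof.
have := sesqC_r hB 1 x 0 0; rewrite scaler0 addr0 !polyC1 scale1r => e.
by apply: (addrI (B x 0)); rewrite addr0 -e.
Qed.

End Sesquilinear.

Section LowOrderCoefficients.
Context {X Y : Type} {Z : nmodType}.

Lemma tprod_coef0 (B : X -> Y -> Z) x y : tprod B x y 0%N = B (x 0%N) (y 0%N).
Proof. by rewrite /tprod big_ord_recl big_ord0 addr0. Qed.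

Lemma tprod_coef1 (B : X -> Y -> Z) x y :
  tprod B x y 1%N = B (x 0%N) (y 1%N) + B (x 1%N) (y 0%N).
Proof. by rewrite /tprod !big_ord_recl big_ord0 addr0. Qed.

Lemma tapp_coef0 (h : nat -> X -> Z) x : tapp h x 0%N = h 0%N (x 0%N).
Proof. by rewrite /tapp /tprod big_ord_recl big_ord0 addr0. Qed.

Lemma tapp_coef1 (h : nat -> X -> Z) x :
  tapp h x 1%N = h 0%N (x 1%N) + h 1%N (x 0%N).
Proof. by rewrite /tapp /tprod !big_ord_recl big_ord0 addr0. Qed.

End LowOrderCoefficients.

(** The embedding of a module into its formal power series. *)
Definition tconst (X : nmodType) (x : X) (n : nat) : X :=
  if n is 0 then x else 0.

Section Deformation.
Context {RR : realType} {T U : lmodType {poly RR[i]}}.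
Context {m : T -> T -> lam T} {l : T -> U -> lam U} {r : U -> T -> lam U}.
Context {H : T -> T -> lam U} {R : {linear U -> T}}.
Implicit Types Rt : nat -> {linear U -> T}.

Lemma tapp_tconst0 Rt u :
  (forall u, Rt 0%N u = R u) -> tapp (fun i => Rt i) (tconst _ u) 0%N = R u.
Proof. by move=> R0; rewrite tapp_coef0 R0. Qed.

Lemma tapp_tconst1 Rt u : tapp (fun i => Rt i) (tconst _ u) 1%N = Rt 1%N u.
Proof. by rewrite tapp_coef1 linear0 add0r. Qed.

Lemma linear_term_cocycle Rt :
  sesquilinear l -> sesquilinear r ->
  formal_deformation m l r H R Rt -> one_cocycle m l r H R (Rt 1%N).
Proof.
move=> hl hr [R0 hRt] u v.
have := hRt (tconst _ u) (tconst _ v) 1%N.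
(* Only the outer [tapp] on the right is expanded here; those applied to constant series are left to
   the [tapp_tconst] lemmas. *)
rewrite /= [tprod m _ _ _]tprod_coef1 [in X in _ = X -> _]tapp_coef1.
rewrite ![tprod _ _ _ 1%N]tprod_coef1 ![tprod _ _ _ 0%N]tprod_coef0.
(* Constant series have no t-term, so the products with [u_1 = 0] or [v_1 = 0] vanish, while [H]
   keeps both of its mixed terms. *)
rewrite !(tapp_tconst0 _ _ R0) !tapp_tconst1 /= (sesq0l hr) (sesq0r hl).
by rewrite addr0 add0r addrA (eq_lam_map _ _ R0).
Qed.

Lemma linear_term_class Rt Rt' :
  formal_deformation m l r H R Rt -> formal_deformation m l r H R Rt' ->
  equivalent_deformations m l r H R Rt Rt' ->
  same_class m l r H R (Rt 1%N) (Rt' 1%N).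
Proof.
move=> [R0 _] [R0' _] [p [phi [psi [_ /morph_R hmor]]]].
(* The element [p] of the equivalence also defines the coboundary, since [phi_1] and [psi_1] are
   built from it. *)
exists p => u; have := hmor (tconst _ u) 1%N.
rewrite !tapp_coef1 !tapp_coef0 /= linear0 add0r R0 lamC0 add0r.
rewrite (eq_lam_map _ _ R0') lam_mapC lamCB /coboundary => e.
(* Move [R'_1 u] to the right; [e] then turns it into [R_1 u + phi_1 (R u) - phi_1 (R u)]. *)
by apply/eqP; rewrite subr_eq addrAC -e addrK.
Qed.

End Deformation.

Theorem theorem4p7 (RR : realType) (T U : lmodType {poly RR[i]})
    (m : T -> T -> lam T) (l : T -> U -> lam U) (r : U -> T -> lam U)
    (H : T -> T -> lam U) (R : {linear U -> T})
    (Rt : nat -> {linear U -> T})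
    (hm : assoc_conformal_algebra m) (hlr : conformal_bimodule m l r)
    (hH : hochschild_2cocycle m l r H) (hR : twisted_RB m l r H R)
    (hRt : formal_deformation m l r H R Rt) :
  one_cocycle m l r H R (Rt 1%N) /\
  (forall Rt' : nat -> {linear U -> T},
     formal_deformation m l r H R Rt' ->
     equivalent_deformations m l r H R Rt Rt' ->
     same_class m l r H R (Rt 1%N) (Rt' 1%N)).
Proof.
split=> [|Rt' hRt' heq]; last exact: linear_term_class heq.
exact: (linear_term_cocycle _ (bimod_sesql hlr) (bimod_sesqr hlr) hRt).
Qed.
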